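(* Let $(X_t)_{t\ge0}$ be a continuous-time Markov chain on a finite state space $\Omega$ which is reversible with respect to the invariant probability measure $\pi$, where $\pi\{\omega\}>0$ for all $\omega\in\Omega$. Let $(T_t)_{t\ge0}$ be the semigroup defined by $T_tf(x)=\mathbb{E}^xf(X_t)$ for $f:\Omega\to\mathbb{R}$. Assume $(T_t)_{t\ge0}$ satisfies $1$-logSob with constant $C>0$. Let $a,b\ge0$ and let $A,B\subseteq\Omega$ with $\pi\{A\}=\exp(-a^2/2)$ and $\pi\{B\}=\exp(-b^2/2)$. Let $X_0$ be distributed according to $\pi$. Then for every $t>0$ $$\mathbb{P}\{X_0\in A,\ X_t\in B\}\ge\exp\left(-\frac12\,\frac{a^2+2e^{-2t/C}ab+b^2}{1-e^{-4t/C}}\right).$$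
   Context: $\mathbb{E}^x$ denotes expectation for the chain started at $x$. Write $T_t=e^{-tL}$ ($-L$ is the transition rate matrix of the chain), $\mathbb{E}f=\int_\Omega f\,d\pi$, and let $\mathcal{E}(f,g)=\mathbb{E}[fLg]$ be the Dirichlet form. For $f>0$ let $Ent(f)=\mathbb{E}(f\log f)-\mathbb{E}f\cdot\log\mathbb{E}f$. $1$-logSob is satisfied with constant $C>0$ if $Ent(f)\le\frac{C}{4}\mathcal{E}(f,\log f)$ for every strictly positive $f:\Omega\to\mathbb{R}$. *)

(* Defs.v *)
From HB Require Import structures.
From mathcomp Require Import all_boot all_order all_algebra.
From mathcomp Require Import all_classical all_reals all_analysis.

Set Implicit Arguments.
Unset Strict Implicit.
Unset Printing Implicit Defensive.

Import Order.TTheory GRing.Theory Num.Theory.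
Import numFieldNormedType.Exports.

Local Open Scope classical_set_scope.
Local Open Scope ring_scope.

Section FiniteSpace.
Context {R : realType} {Omega : finType}.
Implicit Types (p f g : Omega -> R) (A : {set Omega}) (Q : Omega -> Omega -> R).

Definition is_pos_prob p : Prop := (forall x, 0 < p x) /\ \sum_x p x = 1.

Definition mass p A : R := \sum_(x in A) p x.

Definition mean p f : R := \sum_x p x * f x.

Definition rate_matrix Q : Prop :=
  (forall x y, x != y -> 0 <= Q x y) /\ (forall x, \sum_y Q x y = 0).

(* [-L] is the action of the rate matrix on functions. *)
Definition genL Q f : Omega -> R := fun x => - \sum_y Q x y * f y.

(* Detailed balance; with zero row sums it makes [p] invariant. *)
Definition reversible Q p : Prop := forall x y, p x * Q x y = p y * Q y x.

(* Exponential of a linear operator on functions, as a pointwise power series. *)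
Definition op_exp (K : (Omega -> R) -> (Omega -> R)) f : Omega -> R :=
  fun x => limn (series (fun k : nat => (k`!%:R)^-1 * iter k K f x)).

Definition dirichlet Q p f g : R := mean p (fun x => f x * genL Q g x).

Definition Ent p f : R :=
  mean p (fun x => f x * ln (f x)) - mean p f * ln (mean p f).

Definition logSob1 Q p (C : R) : Prop :=
  forall f, (forall x, 0 < f x) ->
    Ent p f <= C / 4 * dirichlet Q p f (fun x => ln (f x)).

End FiniteSpace.

Section MarkovChain.
Context {R : realType} {d : measure_display} {T : measurableType d}.
Context {Omega : finType}.
(* [Px x] is the law of the chain started at [x], [X t] the state at time [t];
   only times [t >= 0] are ever used. *)
Variables (Px : Omega -> probability T R) (X : R -> T -> Omega).

(* Conditional probabilities given the states at [t 0 <= ... <= t n] are those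
   of the chain started afresh at the last state; the product form avoids
   conditioning on null events. Values of [t] and [z] beyond [n] are unused. *)
Definition markov_property (P : probability T R) : Prop :=
  forall (n : nat) (t : nat -> R) (z : nat -> Omega) (s : R) (y : Omega),
    0 <= t 0%N -> (forall i, t i <= t i.+1) -> 0 <= s ->
    (P ([set w | forall i, (i <= n)%N -> X (t i) w = z i] `&`
        [set w | X (t n + s)%R w = y]) =
     P [set w | forall i, (i <= n)%N -> X (t i) w = z i] *
       Px (z n) [set w | X s w = y])%E.

Definition semigroup (t : R) (f : Omega -> R) : Omega -> R :=
  fun x => fine ('E_(Px x)[fun w => f (X t w)]).

Definition has_rates (Q : Omega -> Omega -> R) : Prop :=
  rate_matrix Q /\
  forall (t : R) f x, 0 <= t ->
    semigroup t f x = op_exp (fun g z => - t * genL Q g z) f x.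

Definition markov_chain (Q : Omega -> Omega -> R) : Prop :=
  [/\ forall (t : R) x, 0 <= t -> measurable (X t @^-1` [set x]),
      forall x, Px x [set w | X 0 w = x] = 1%E,
      forall x, markov_property (Px x)
    & has_rates Q].

(* [P] is the law of the same chain with initial distribution [p]. *)
Definition chain_law_from (p : Omega -> R) (P : probability T R) : Prop :=
  markov_property P /\ forall x, P [set w | X 0 w = x] = (p x)%:E.

End MarkovChain.

(* Main.v *)
Require Import Defs.
From HB Require Import structures.
From mathcomp Require Import all_boot all_order all_algebra.
From mathcomp Require Import all_classical all_reals all_analysis.
From mathcomp Require Import ring lra.
Import Order.TTheory GRing.Theory Num.Theory.
Import numFieldNormedType.Exports.
Local Open Scope classical_set_scope.
Local Open Scope ring_scope.

Set Implicit Arguments.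
Unset Strict Implicit.
Unset Printing Implicit Defensive.

(** The bound follows from reverse hypercontractivity, which bounds [E[f T_t g]]
below by norms of [f] and [g] with exponents less than [1]; it is applied to
functions close to the indicators of [A] and [B].  Write [T_t] for the semigroup and, for [r > 0], [||g||_r]
for [(E g^r)^(1/r)]; as [r] tends to [0] it tends to [||g||_0 = exp (E ln g)].

Let [g > 0], [0 < q < 1] and [r(s) = 1 - (1 - q) e^(4s/C)].  As long as
[r(s) > 0] the quantity [||T_s g||_(r(s))] is nondecreasing in [s].  With
[w = (T_s g)^(r(s))], the derivative of its logarithm has the sign of
[r' Ent(w) - r^2 E((T_s g)^(r-1), T_s g)].  The 1-log-Sobolev inequality
applied to [w] bounds the entropy by [E(w, ln w)], and the two Dirichlet forms
compare edge by edge through an elementary inequality between exponentials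
([expR_varopoulos], [dirichlet_varopoulos]).  The speed of the exponent [r] is
the one for which the two terms balance.

The exponent reaches [0] at the time [s] with [1 - q = e^(-4s/C)], and a
passage to the limit gives [||T_s g||_0 >= ||g||_q] there
([logNorm_le_mean_ln_evolve]).  For [(1 - q1)(1 - q2) = e^(-4t/C)] split
[t = s1 + s2] into the two corresponding times.  By the semigroup property,
self-adjointness and Jensen's inequality for [ln],
[E[f T_t g] = E[T_s1 f T_s2 g] >= ||T_s1 f||_0 ||T_s2 g||_0
>= ||f||_q1 ||g||_q2] ([reverse_holder]).  Shrinking positive perturbations of
the indicators give the lower bound [pi(A)^(1/q1) pi(B)^(1/q2)]; with
[rho = e^(-2t/C)] the best exponents under the constraint are
[q1 = (1 - rho^2) a / (a + rho b)] and [q2 = (1 - rho^2) b / (b + rho a)], and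
they turn it into the stated bound ([joint_lower_bound]).

The power series of [e^(-tL)] supplies reversibility of the transition kernel
and the backward equation; positivity and the semigroup law come from the
process, the former because the kernel consists of probabilities and the latter
from the Markov property ([chain_reversible_semigroup]). *)

(** * Elementary inequalities *)

Lemma wmean_gt0 (R : realType) (I : finType) (w G : I -> R) :
  (forall i, 0 <= w i) -> \sum_i w i = 1 -> (forall i, 0 < G i) ->
  0 < \sum_i w i * G i.
Proof.
move=> w0 w1 G0.
have h i : true -> 0 <= w i * G i by move=> _; rewrite mulr_ge0// ltW.
rewrite lt0r sumr_ge0 ?andbT//; apply/eqP => /(psumr_eq0P h) mE.
have w00 i : w i = 0.
  by have /eqP := mE i isT; rewrite mulf_eq0 (gt_eqF (G0 i)) orbF => /eqP.
by move: w1; rewrite big1// => /eqP; rewrite eq_sym oner_eq0.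
Qed.

(** Jensen's inequality for [ln]: apply [ln u <= u - 1] to each [u = G i / m],
where [m] is the weighted mean; the terms [u - 1] average to [0]. *)
Lemma sum_ln_le_ln_sum (R : realType) (I : finType) (w G : I -> R) :
  (forall i, 0 <= w i) -> \sum_i w i = 1 -> (forall i, 0 < G i) ->
  \sum_i w i * ln (G i) <= ln (\sum_i w i * G i).
Proof.
move=> w0 w1 G0; have := wmean_gt0 w0 w1 G0.
set m := \sum_i w i * G i => m0.
have -> : ln m = \sum_i w i * (ln m + (G i / m - 1)).
  under eq_bigr do rewrite mulrDr mulrBr mulr1 mulrA.
  by rewrite big_split/= sumrB -!mulr_suml w1 divff ?gt_eqF// subrr addr0 mul1r.
apply: ler_sum => i _; rewrite ler_wpM2l// -lerBlDl -ln_div ?posrE//.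
rewrite -[X in ln X](subrK 1) [X in ln X]addrC le_ln1Dx//.
by rewrite ltrBDr addNr divr_gt0.
Qed.

Section pointwise.
Variable R : realType.
Implicit Types r v h k : R.

Lemma is_derive_expRM (c v : R) :
  is_derive v 1 (fun v => expR (c * v)) (c * expR (c * v)).
Proof.
have h : is_derive v 1 (fun v : R => c * v) c.
  have := @is_deriveZ R R R id c v 1 1 _; rewrite /GRing.scale /= mulr1; exact.
have := @is_derive1_comp R expR (fun v => c * v) v _ _ (is_derive_expR _) h.
by rewrite mulrC.
Qed.

Definition twice_sinh v := expR v - expR (- v).

Lemma is_derive_twice_sinh r v :
  is_derive v 1 (fun v => twice_sinh (r * v)) (r * (expR (r * v) + expR (- (r * v)))).
Proof.
have := is_deriveB (is_derive_expRM r v) (is_derive_expRM (- r) v).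
rewrite (_ : _ - _ = fun v => twice_sinh (r * v)); last first.
  by apply/funext => u; rewrite /twice_sinh -mulNr.
by rewrite mulNr opprK -mulrDr mulNr.
Qed.

Lemma twice_cosh_le v w : 0 <= v -> v <= w ->
  expR v + expR (- v) <= expR w + expR (- w).
Proof.
move=> v0 vw; rewrite !expRN.
have a1 : 1 <= expR v by rewrite -[X in X <= _](@expR0 R) ler_expR.
have ab : expR v <= expR w by rewrite ler_expR.
have b0 : 0 < expR w by rewrite expR_gt0.
have a0 : 0 < expR v by rewrite expR_gt0.
rewrite -subr_ge0.
have -> : expR w + (expR w)^-1 - (expR v + (expR v)^-1) =
  (expR w - expR v) * (expR v * expR w - 1) / (expR v * expR w).
  by field; rewrite !gt_eqF.
apply: divr_ge0; last by rewrite mulr_ge0// ltW.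
by apply: mulr_ge0; nra.
Qed.

Lemma ge0_of_derive (f df : R -> R) :
  (forall v, 0 <= v -> is_derive v 1 f (df v)) ->
  (forall v, 0 <= v -> 0 <= df v) -> forall v, 0 <= v -> f 0 <= f v.
Proof.
move=> fE df0 v v0; apply: (@ger0_derive1_ndecr R f 0 v) => //.
- by move=> x; rewrite in_itv/= => /andP[/ltW/fE[]].
- move=> x; rewrite in_itv/= => /andP[/ltW x0 _].
  by have [_ ] := fE x x0; rewrite derive1E => ->; exact: df0.
- apply: derivable_within_continuous => x; rewrite in_itv/= => /andP[x0 _].
  by have [] := fE x x0.
Qed.

(** The difference has the nonnegative derivative [2 cosh v - 2]. *)
Lemma twice_sinh_ge v : 0 <= v -> 2 * v <= twice_sinh v.
Proof.
move=> v0; rewrite -subr_ge0.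
pose f u : R := twice_sinh (1 * u) - 2 * u.
have f' (u : R) : 0 <= u -> is_derive u 1 f (1 * (expR (1 * u) + expR (- (1 * u))) - 2).
  move=> u0; apply: is_deriveB; first exact: is_derive_twice_sinh.
  have := @is_deriveZ R R R id 2 u 1 1 _; rewrite /GRing.scale /= mulr1; exact.
have := ge0_of_derive f' _ v0.
rewrite /f mulr0 /twice_sinh oppr0 subrr mulr0 subrr !mul1r; apply=> u u0.
rewrite !mul1r subr_ge0.
by have := twice_cosh_le (lexx 0) u0; rewrite oppr0 expR0.
Qed.

(** Convexity of [sinh] on the half-line; it holds because
[cosh (r v) <= cosh v]. *)
Lemma twice_sinh_scale_le r v : 0 <= r -> r <= 1 -> 0 <= v ->
  twice_sinh (r * v) <= r * twice_sinh v.
Proof.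
move=> r0 r1 v0; rewrite -subr_ge0.
pose f u : R := r * twice_sinh (1 * u) - twice_sinh (r * u).
have f' (u : R) : 0 <= u -> is_derive u 1 f
    (r * (1 * (expR (1 * u) + expR (- (1 * u)))) - r * (expR (r * u) + expR (- (r * u)))).
  move=> u0; apply: is_deriveB; last exact: is_derive_twice_sinh.
  apply: is_deriveZ; exact: is_derive_twice_sinh.
have := ge0_of_derive f' _ v0.
rewrite /f !mulr0 /twice_sinh oppr0 subrr mulr0 subrr !mul1r; apply=> u u0.
rewrite !mul1r -mulrBr mulr_ge0// subr_ge0.
by apply: twice_cosh_le; [exact: mulr_ge0 | exact: ler_piMl].
Qed.

(** One edge of the comparison of Dirichlet forms, with [e^h] and [e^k] the values
of the function at the endpoints.  With [v] the half-difference of [h] and [k],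
it reads
[(1 - r) (2 v) sinh (r v) <= r sinh ((1 - r) v) (2 sinh v)],
which is the product of [(1 - r) v <= sinh ((1 - r) v)] and
[sinh (r v) <= r sinh v]. *)
Lemma expR_varopoulos r h k : 0 <= r -> r <= 1 ->
  r * ((expR ((r - 1) * h) - expR ((r - 1) * k)) * (expR h - expR k)) +
  (1 - r) * ((expR (r * h) - expR (r * k)) * (h - k)) <= 0.
Proof.
move=> r0 r1; wlog hk : h k / k <= h.
  move=> H; have [|/ltW] := leP k h; first exact: H.
  by move=> /H; congr (_ <= 0); ring.
(* Factoring out the midpoint [c] leaves an odd function of [v]. *)
set c := (h + k) / 2; set v := (h - k) / 2.
have v0 : 0 <= v by rewrite divr_ge0// subr_ge0.
have -> : h = c + v by rewrite /c /v; field.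
have -> : k = c - v by rewrite /c /v; field.
have E : r * ((expR ((r - 1) * (c + v)) - expR ((r - 1) * (c - v))) *
    (expR (c + v) - expR (c - v))) +
  (1 - r) * ((expR (r * (c + v)) - expR (r * (c - v))) * (c + v - (c - v))) =
  expR (r * c) * ((1 - r) * twice_sinh (r * v) * (2 * v) -
    r * twice_sinh ((1 - r) * v) * twice_sinh v).
  have -> : (r - 1) * (c + v) = r * c - c - (1 - r) * v by ring.
  have -> : (r - 1) * (c - v) = r * c - c + (1 - r) * v by ring.
  rewrite ![r * (_ + _)]mulrDr !mulrN.
  rewrite !expRD /twice_sinh [expR (- c)]expRN; field.
  by rewrite gt_eqF// expR_gt0.
rewrite E pmulr_rle0 ?expR_gt0// subr_le0.
have A1 := twice_sinh_ge v0; have A2 := twice_sinh_scale_le r0 r1 v0.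
have q0 : 0 <= (1 - r) * v by rewrite mulr_ge0// subr_ge0.
have A3 := twice_sinh_ge q0.
have s0 : 0 <= twice_sinh (r * v).
  have rv0 := mulr_ge0 r0 v0.
  by have := twice_sinh_ge rv0; apply: le_trans; rewrite mulr_ge0.
have -> : (1 - r) * twice_sinh (r * v) * (2 * v) =
  (2 * ((1 - r) * v)) * twice_sinh (r * v) by ring.
have -> : r * twice_sinh ((1 - r) * v) * twice_sinh v =
  twice_sinh ((1 - r) * v) * (r * twice_sinh v) by ring.
by apply: ler_pM => //; rewrite mulr_ge0.
Qed.
End pointwise.

(** * Comparison of Dirichlet forms *)

Section dirichlet_form.
Context {R : realType} {Omega : finType}.
Variables (Q : Omega -> Omega -> R) (p : Omega -> R).
Hypotheses (hQ : rate_matrix Q) (hrev : reversible Q p).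
Implicit Types f g h : Omega -> R.

(** Detailed balance makes the form symmetric, and zero row sums remove the
diagonal terms. *)
Lemma dirichletE f g : dirichlet Q p f g =
  2^-1 * \sum_x \sum_y p x * Q x y * ((f x - f y) * (g x - g y)).
Proof.
have [_ Q0] := hQ.
pose D := \sum_x \sum_y p x * Q x y * (f x * (g x - g y)).
have E1 : dirichlet Q p f g = D.
  apply: eq_bigr => x _; rewrite /genL.
  transitivity (p x * f x * (g x * \sum_y Q x y - \sum_y Q x y * g y)).
    by rewrite Q0; ring.
  rewrite mulr_sumr -sumrB mulr_sumr; apply: eq_bigr => y _; ring.
have E2 : D = \sum_x \sum_y p x * Q x y * (f y * (g y - g x)).
  rewrite /D exchange_big/=; apply: eq_bigr => x _; apply: eq_bigr => y _.
  by rewrite hrev.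
have -> : \sum_x \sum_y p x * Q x y * ((f x - f y) * (g x - g y)) = D + D.
  rewrite {2}E2 /D -big_split/=; apply: eq_bigr => x _.
  rewrite -big_split/=; apply: eq_bigr => y _; ring.
by rewrite E1; field.
Qed.

(** Links two forms of [G = e^h]: [E(G^(r-1), G)] appears when the norm
[||T_s g||_r] is differentiated in [s], and [E(G^r, ln G)] is what the
log-Sobolev inequality for [G^r] controls.  The inequality holds on each edge, by
[expR_varopoulos]. *)
Lemma dirichlet_varopoulos r h : (forall x, 0 <= p x) -> 0 <= r -> r <= 1 ->
  r * dirichlet Q p (fun x => expR ((r - 1) * h x)) (fun x => expR (h x)) +
  (1 - r) * dirichlet Q p (fun x => expR (r * h x)) h <= 0.
Proof.
move=> p0 r0 r1; rewrite !dirichletE mulrCA [X in _ + X]mulrCA -mulrDr.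
rewrite pmulr_rle0 ?invr_gt0// !mulr_sumr -big_split/= sumr_le0// => x _.
rewrite !mulr_sumr -big_split/= sumr_le0// => y _.
have [->|xy] := eqVneq x y; first by rewrite !subrr !mulr0 addr0.
rewrite mulrCA [X in _ + X]mulrCA -mulrDr mulr_ge0_le0//.
  by rewrite mulr_ge0//; apply: hQ.1.
exact: expR_varopoulos.
Qed.

End dirichlet_form.

(** * Reverse hypercontractivity *)

(** The properties of the transition kernel that the analytic argument uses.
The Markov properties are confined to nonnegative times, where they come from
the process; [kernel_rev] and [kernel_derive] hold at all real times because they
come from the matrix exponential, and the derivative at time [0] is two-sided. *)
Record reversible_semigroup (R : realType) (Omega : finType)
    (Q : Omega -> Omega -> R) (p : Omega -> R)
    (K : R -> Omega -> Omega -> R) : Prop := ReversibleSemigroup {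
  kernel_ge0 : forall (s : R) x y, 0 <= s -> 0 <= K s x y;
  kernel_sum1 : forall (s : R) x, 0 <= s -> \sum_y K s x y = 1;
  kernel0 : forall x y, K 0 x y = (x == y)%:R;
  kernelD : forall (s t : R) x z, 0 <= s -> 0 <= t ->
    K (s + t) x z = \sum_y K s x y * K t y z;
  kernel_rev : forall (s : R) x y, p x * K s x y = p y * K s y x;
  kernel_derive : forall (s : R) x y,
    is_derive s 1 (fun s : R => K s x y) (\sum_z Q x z * K s z y) }.

Lemma is_derive_fsum (R : realType) (I : finType) (F : I -> R -> R) (dF : I -> R)
    (s : R) : (forall i, is_derive s 1 (F i) (dF i)) ->
  is_derive s 1 (fun s => \sum_i F i s) (\sum_i dF i).
Proof.
move=> h; rewrite (_ : (fun s => _) = \sum_i F i); last first.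
  by apply/funext => u; rewrite fct_sumE.
by elim/big_ind2 : _ => // [|*]; [exact: is_derive_cst|exact: is_deriveD].
Qed.

Section reverse_hypercontractivity.
Context {R : realType} {Omega : finType}.
Variables (Q : Omega -> Omega -> R) (p : Omega -> R) (K : R -> Omega -> Omega -> R).
Hypotheses (hQ : rate_matrix Q) (hrev : reversible Q p) (hp : is_pos_prob p).
Hypothesis hK : reversible_semigroup Q p K.
Variable C : R.
Hypotheses (hC : 0 < C) (hLS : logSob1 Q p C).
Implicit Types f g h : Omega -> R.

Definition evolve (s : R) g : Omega -> R := fun x => \sum_y K s x y * g y.

(** The logarithm of the [L^r] norm [(E g^r)^(1/r)] of a positive [g]. *)
Definition logNorm (r : R) g : R := ln (mean p (fun x => expR (r * ln (g x)))) / r.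

Lemma evolve_gt0 s g : 0 <= s -> (forall x, 0 < g x) -> forall x, 0 < evolve s g x.
Proof.
move=> s0 g0 x; apply: wmean_gt0 => //; last exact: (kernel_sum1 hK).
by move=> y; apply: (kernel_ge0 hK).
Qed.

Lemma evolve0 g : evolve 0 g = g.
Proof.
apply/funext => x; rewrite /evolve (bigD1 x)//= (kernel0 hK) eqxx mul1r big1 ?addr0//.
by move=> y yx; rewrite (kernel0 hK) eq_sym (negPf yx) mul0r.
Qed.

Lemma evolveD s t g : 0 <= s -> 0 <= t -> evolve (s + t) g = evolve s (evolve t g).
Proof.
move=> s0 t0; apply/funext => x; rewrite /evolve.
under eq_bigr do rewrite (kernelD hK)// mulr_suml.
rewrite exchange_big/=; apply: eq_bigr => y _; rewrite mulr_sumr.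
by apply: eq_bigr => z _; rewrite mulrA.
Qed.

Lemma mean_evolve_sym s f g :
  mean p (fun x => f x * evolve s g x) = mean p (fun x => evolve s f x * g x).
Proof.
rewrite /mean /evolve.
transitivity (\sum_x \sum_y p x * K s x y * (f x * g y)).
  by apply: eq_bigr => x _; rewrite !mulr_sumr; apply: eq_bigr => y _; ring.
rewrite exchange_big/=; apply: eq_bigr => x _.
rewrite mulr_suml mulr_sumr; apply: eq_bigr => y _.
rewrite (kernel_rev hK); ring.
Qed.

Lemma mean_evolve s g : 0 <= s -> mean p (evolve s g) = mean p g.
Proof.
move=> s0; have := mean_evolve_sym s (fun=> 1) g.
have -> : evolve s (fun=> 1) = fun=> 1.
  apply/funext => x; rewrite /evolve; under eq_bigr do rewrite mulr1.
  exact: (kernel_sum1 hK).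
have E (u : Omega -> R) : (fun x => 1 * u x) = u by apply/funext => x; rewrite mul1r.
by rewrite !E.
Qed.

Lemma is_derive_evolve (s : R) g x :
  is_derive s 1 (fun s => evolve s g x) (\sum_y Q x y * evolve s g y).
Proof.
have -> : \sum_y Q x y * evolve s g y = \sum_y g y * \sum_z Q x z * K s z y.
  under eq_bigr do rewrite mulr_sumr.
  rewrite exchange_big/=; apply: eq_bigr => y _; rewrite mulr_sumr.
  by apply: eq_bigr => z _; ring.
rewrite /evolve; apply: is_derive_fsum => y.
have -> : (fun s => K s x y * g y) = g y \*: (fun s => K s x y).
  by apply/funext => u; rewrite mulrC.
exact/is_deriveZ/(kernel_derive hK).
Qed.

Section flow.
Variables (q : R) (g : Omega -> R).
Hypotheses (q1 : q < 1) (g0 : forall x, 0 < g x).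

(** The exponent solves [r' = - (4 / C) (1 - r)], [r(0) = q]. *)
Definition expo (s : R) : R := 1 - (1 - q) * expR (4 / C * s).

Lemma expo_lt1 s : expo s < 1.
Proof. by rewrite /expo gtrBl mulr_gt0 ?expR_gt0// subr_gt0. Qed.

Lemma expo_anti s t : s <= t -> expo t <= expo s.
Proof.
move=> st; rewrite lerB// ler_wpM2l ?ler_expR ?ler_wpM2l//.
  by rewrite subr_ge0 ltW.
by rewrite divr_ge0// ltW.
Qed.

Lemma is_derive_expo (s : R) : is_derive s 1 expo (- (4 / C * (1 - expo s))).
Proof.
have := is_deriveZ (1 - q) (is_derive_expRM (4 / C) s).
move=> /(is_deriveB (is_derive_cst (1 : R) s 1)) h.
apply: (is_derive_eq h).
rewrite /expo /GRing.scale/=; ring.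
Qed.

Let mass_flow s := mean p (fun x => expR (expo s * ln (evolve s g x))).

Let mass_flow_gt0 s : 0 < mass_flow s.
Proof. by apply: wmean_gt0 => [x||x]; [apply/ltW/hp.1|exact: hp.2|exact: expR_gt0]. Qed.

Let d_mass_flow s := \sum_x p x * (expR (expo s * ln (evolve s g x)) *
   (expo s * ((evolve s g x)^-1 * \sum_y Q x y * evolve s g y)
    - 4 / C * (1 - expo s) * ln (evolve s g x))).

Let is_derive_mass_flow (s : R) : 0 <= s -> is_derive s 1 mass_flow (d_mass_flow s).
Proof.
move=> s0; apply: is_derive_fsum => x.
apply: is_deriveZ.
apply: (@is_derive1_comp R expR (fun s => expo s * ln (evolve s g x))).
have G0 := evolve_gt0 s0 g0 x.
have hl : is_derive s 1 (fun s => ln (evolve s g x))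
    ((evolve s g x)^-1 * \sum_y Q x y * evolve s g y).
  exact: (is_derive1_comp (is_derive1_ln G0) (is_derive_evolve s g x)).
apply: (is_derive_eq (is_deriveM (is_derive_expo s) hl)).
by rewrite /GRing.scale/= mulrN mulrC [X in _ - X]mulrC.
Qed.

(** After clearing the positive factor [r^2 E G^r], where [G = T_s g], the
derivative is [r' Ent(G^r) - r^2 E(G^(r-1), G)].  Since
[r' = - (4 / C) (1 - r)], the log-Sobolev inequality for [G^r] bounds the first
term below by [- (1 - r) E(G^r, ln (G^r))], which [dirichlet_varopoulos] shows
to be compensated by the second. *)
Lemma logNorm_flow_derive (s : R) : 0 <= s -> 0 < expo s ->
  exists2 d, 0 <= d & is_derive s 1 (fun s => logNorm (expo s) (evolve s g)) d.
Proof.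
move=> s0 e0; have e1 := expo_lt1 s.
have G0 := evolve_gt0 s0 g0.
have hS := is_derive_mass_flow s0.
have hlS : is_derive s 1 (fun s => ln (mass_flow s)) ((mass_flow s)^-1 * d_mass_flow s).
  exact: (is_derive1_comp (is_derive1_ln (mass_flow_gt0 s)) hS).
have hV := is_deriveV (lt0r_neq0 e0) (is_derive_expo s).
have hF := is_deriveM hlS hV.
set r := expo s in e0 e1 hS hV hF *.
set S := mass_flow s in hS hlS hF.
have S0 : 0 < S by exact: mass_flow_gt0.
set h := fun x => ln (evolve s g x).
have Gh x : evolve s g x = expR (h x) by rewrite /h lnK ?posrE.
set w := fun x => expR (r * h x).
have w0 x : 0 < w x by exact: expR_gt0.
have := hLS w0.
rewrite /Ent (_ : mean p w = S)//.
have -> : (fun x => ln (w x)) = (fun x => r * h x) by apply/funext => x; rewrite /w expRK.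
have -> : mean p (fun x => w x * ln (w x)) = r * \sum_x p x * (w x * h x).
  by rewrite mulr_sumr; apply: eq_bigr => x _; rewrite /w expRK; ring.
have -> : dirichlet Q p w (fun x => r * h x) = r * dirichlet Q p w h.
  rewrite /dirichlet /mean mulr_sumr; apply: eq_bigr => x _; rewrite /genL.
  under eq_bigr do rewrite mulrCA.
  by rewrite -mulr_sumr; ring.
(* [D1] and [D2] are [E(G^r, ln G)] and [E(G^(r-1), G)], and [N] is [E[G^r ln G]]. *)
have V := dirichlet_varopoulos hQ hrev h (fun x => ltW (hp.1 x)) (ltW e0) (ltW e1).
set N := \sum_x p x * (w x * h x) => LS.
set D1 := dirichlet Q p w h in LS; rewrite -/w -/D1 in V.
set D2 := dirichlet Q p _ _ in V.
have D2E : \sum_x p x * (w x * ((evolve s g x)^-1 * \sum_y Q x y * evolve s g y)) = - D2.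
  rewrite /D2 /dirichlet /mean -sumrN; apply: eq_bigr => x _.
  rewrite /genL !mulrN opprK Gh -expRN /w [expR (r * _) * _]mulrA -expRD.
  congr (_ * (_ * _)); first by congr expR; ring.
  by apply: eq_bigr => y _; rewrite Gh.
have dSE : d_mass_flow s = r * - D2 - 4 / C * (1 - r) * N.
  rewrite -D2E /N !mulr_sumr -sumrB; apply: eq_bigr => x _.
  by rewrite -/r -/(h x) -/(w x); ring.
eexists; last exact: hF.
rewrite dSE /GRing.scale/= -/S.
have -> : ln S * (- r ^- 2 * - (4 / C * (1 - r))) +
    r^-1 * (S^-1 * (r * - D2 - 4 / C * (1 - r) * N))
  = (4 / C * (1 - r) * (S * ln S - r * N) - r ^+ 2 * D2) / (r ^+ 2 * S).
  by field; rewrite !gt_eqF.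
apply: divr_ge0; last by rewrite mulr_ge0 ?exprn_ge0// ltW.
have LS' : 4 / C * (1 - r) * (r * N - S * ln S) <= (1 - r) * (r * D1).
  have -> : (1 - r) * (r * D1) = 4 / C * (1 - r) * (C / 4 * (r * D1)).
    by field; rewrite gt_eqF.
  by rewrite ler_wpM2l// mulr_ge0 ?divr_ge0 ?subr_ge0// ltW.
have V' : r * (r * D2 + (1 - r) * D1) <= 0 by rewrite pmulr_rle0.
rewrite expr2; lra.
Qed.

Lemma logNorm_flow (s : R) : 0 <= s -> 0 < expo s ->
  logNorm q g <= logNorm (expo s) (evolve s g).
Proof.
move=> s0 e0.
have -> : logNorm q g = logNorm (expo 0) (evolve 0 g).
  by rewrite evolve0 /expo mulr0 expR0 mulr1 subKr.
have H (u : R) : 0 <= u -> u <= s ->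
    exists2 d, 0 <= d & is_derive u 1 (fun s => logNorm (expo s) (evolve s g)) d.
  move=> u0 us; apply: logNorm_flow_derive => //.
  by rewrite (lt_le_trans e0)// expo_anti.
apply: (@ger0_derive1_ndecr R (fun s => logNorm (expo s) (evolve s g)) 0 s) => //.
- by move=> x; rewrite in_itv/= => /andP[/ltW x0 /ltW/(H x x0)[d _ []]].
- move=> x; rewrite in_itv/= => /andP[/ltW x0 /ltW/(H x x0)[d d0 []]].
  by rewrite derive1E => _ ->.
- apply: derivable_within_continuous => x; rewrite in_itv/=.
  by move=> /andP[x0 /(H x x0)[d _ []]].
Qed.

End flow.

(** Multiply [1 - x <= e^(-x)] by [e^x] and compare with
[(1 + x + 2 x^2) (1 - x) = 1 + x^2 (1 - 2 x)]. *)
Lemma expR_le_quadratic (x : R) : x <= 2^-1 -> expR x <= 1 + x + 2 * x ^+ 2.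
Proof.
move=> x2; have x1 : 0 < 1 - x by lra.
have h : expR x * (1 - x) <= 1.
  rewrite -[leRHS](expRxMexpNx_1 x) ler_wpM2l ?expR_ge0//.
  exact: (expR_ge1Dx (- x)).
rewrite -(ler_pM2r x1); apply: (le_trans h); nra.
Qed.

(** A quantitative form of the convergence of [ln ||g||_r] to [E ln g] as [r]
tends to [0]; the error depends on [g] only through a bound on [|ln g|], so it
is uniform along the semigroup. *)
Lemma logNorm_le_mean_ln (r M : R) g : 0 < r -> r * M <= 2^-1 ->
  (forall x, `|ln (g x)| <= M) ->
  logNorm r g <= mean p (fun x => ln (g x)) + 2 * r * M ^+ 2.
Proof.
move=> r0 rM gM; rewrite /logNorm; set S := mean p _.
have S0 : 0 < S.
  by apply: wmean_gt0 => [x||x]; [apply/ltW/hp.1|exact: hp.2|exact: expR_gt0].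
rewrite ler_pdivrMr//; apply: (@le_trans _ _ (S - 1)).
  by rewrite -[X in ln X](subrKC 1) le_ln1Dx// ltrBDl subrr.
rewrite lerBlDl.
have -> : 1 + (mean p (fun x => ln (g x)) + 2 * r * M ^+ 2) * r =
    \sum_x p x * (1 + r * ln (g x) + 2 * (r * M) ^+ 2).
  under eq_bigr do rewrite mulrDr mulrDr mulr1 (mulrCA _ r).
  rewrite !big_split/= -mulr_sumr -mulr_suml hp.2 /mean; ring.
apply: ler_sum => x _; rewrite ler_wpM2l ?(ltW (hp.1 x))//.
have lM := gM x.
apply: (le_trans (expR_le_quadratic _)).
  apply: (le_trans _ rM); rewrite ler_wpM2l ?(ltW r0)//.
  exact: (le_trans (ler_norm _)).
rewrite lerD2l ler_wpM2l// !exprMn ler_wpM2l ?sqr_ge0//.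
by rewrite -[leLHS]real_normK ?num_real// lerXn2r ?nnegrE// (le_trans _ lM).
Qed.

Lemma ln_evolve_bound (M s : R) g : 0 <= s -> (forall x, 0 < g x) ->
  (forall x, `|ln (g x)| <= M) -> forall x, `|ln (evolve s g x)| <= M.
Proof.
move=> s0 g0 gM x.
have K0 y := kernel_ge0 hK x y s0; have K1 := kernel_sum1 hK x s0.
have cst c : \sum_y K s x y * c = c by rewrite -mulr_suml K1 mul1r.
have G0 := evolve_gt0 s0 g0 x.
rewrite ler_norml; apply/andP; split; rewrite -ler_expR lnK ?posrE//.
  rewrite -[leLHS]cst; apply: ler_sum => y _; rewrite ler_wpM2l//.
  rewrite -[leRHS]lnK ?posrE// ler_expR.
  by have := gM y; rewrite ler_norml => /andP[].
rewrite -[leRHS]cst; apply: ler_sum => y _; rewrite ler_wpM2l//.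
rewrite -[leLHS]lnK ?posrE// ler_expR.
by have := gM y; rewrite ler_norml => /andP[].
Qed.

(** Jensen's inequality for the kernel, averaged against the invariant measure. *)
Lemma mean_ln_evolve_ge s g : 0 <= s -> (forall x, 0 < g x) ->
  mean p (fun x => ln (g x)) <= mean p (fun x => ln (evolve s g x)).
Proof.
move=> s0 g0; rewrite -[leLHS](mean_evolve _ s0); apply: ler_sum => x _.
rewrite ler_wpM2l ?(ltW (hp.1 x))//.
apply: sum_ln_le_ln_sum => //; last exact: (kernel_sum1 hK).
by move=> y; apply: (kernel_ge0 hK).
Qed.

(** At the time [s] at which the exponent reaches [0], where [logNorm] is
singular.  The flow is stopped at the earlier time [s'] at which the exponent is
a small [r > 0]; the remaining time can only increase [E ln], and the error of
[logNorm_le_mean_ln] vanishes with [r]. *)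
Lemma logNorm_le_mean_ln_evolve (q s : R) g : 0 < q -> q < 1 ->
  s = - (C / 4 * ln (1 - q)) -> (forall x, 0 < g x) ->
  logNorm q g <= mean p (fun x => ln (evolve s g x)).
Proof.
move=> q0 q1 sE g0.
pose M := \sum_x `|ln (g x)| + 1.
have M1 : 1 <= M by rewrite lerDr sumr_ge0.
have M0 : 0 < M by exact: lt_le_trans M1.
have gM x : `|ln (g x)| <= M.
  rewrite /M (bigD1 x)//= -addrA lerDl addr_ge0// sumr_ge0//.
have C4 : 0 < C / 4 by rewrite divr_gt0.
apply/ler_addgt0Pr => e e0.
(* The three bounds make [s' >= 0], [r M <= 1/2] and [2 r M^2 <= e]. *)
pose r := Num.min q (Num.min (2 * M)^-1 (e / (2 * M ^+ 2))).
have r0 : 0 < r by rewrite !lt_min q0 invr_gt0 divr_gt0 ?mulr_gt0 ?exprn_gt0.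
have rq : r <= q by rewrite ge_min lexx.
have rM : r * M <= 2^-1.
  have : r <= (2 * M)^-1 by rewrite !ge_min lexx orbT.
  by rewrite invfM -ler_pdivlMr.
have re : 2 * r * M ^+ 2 <= e.
  have : r <= e / (2 * M ^+ 2) by rewrite !ge_min lexx !orbT.
  by rewrite ler_pdivlMr ?mulr_gt0 ?exprn_gt0// mulrA (mulrC r).
have r1 : r < 1 by exact: le_lt_trans q1.
pose s' := C / 4 * (ln (1 - r) - ln (1 - q)).
have qp : 0 < 1 - q by rewrite subr_gt0.
have rp : 0 < 1 - r by rewrite subr_gt0.
have s'0 : 0 <= s'.
  by rewrite mulr_ge0 ?(ltW C4)// subr_ge0 ler_ln ?posrE// lerB.
have s's : 0 <= s - s'.
  rewrite sE /s'; have : ln (1 - r) <= 0 by rewrite ln_le0// gerBl ltW.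
  move=> lr; rewrite (_ : _ - _ = C / 4 * (- ln (1 - r))); last by ring.
  by rewrite mulr_ge0 ?(ltW C4)// oppr_ge0.
have er : expo q s' = r.
  rewrite /expo /s' mulrA (_ : 4 / C * (C / 4) = 1); last by field; rewrite gt_eqF.
  by rewrite mul1r expRB !lnK ?posrE// mulrC divfK ?gt_eqF// subKr.
have := logNorm_flow q1 g0 s'0; rewrite er => /(_ r0)/le_trans; apply.
apply: (le_trans (logNorm_le_mean_ln r0 rM (ln_evolve_bound s'0 g0 gM))).
apply: lerD => //.
rewrite -[s in leRHS](subrK s') evolveD//.
by apply: mean_ln_evolve_ge => //; exact: evolve_gt0.
Qed.

(** Each function is flowed to exponent [0], [f] during [s1] and [g] during [s2];
the constraint on the exponents says exactly that [s1 + s2 = t]. *)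
Lemma reverse_holder (q1 q2 t : R) f g :
  0 < q1 < 1 -> 0 < q2 < 1 -> (1 - q1) * (1 - q2) = expR (- (4 * t / C)) ->
  (forall x, 0 < f x) -> (forall x, 0 < g x) ->
  expR (logNorm q1 f + logNorm q2 g) <= mean p (fun x => f x * evolve t g x).
Proof.
move=> /andP[q10 q11] /andP[q20 q21] qt f0 g0.
pose s1 := - (C / 4 * ln (1 - q1)); pose s2 := - (C / 4 * ln (1 - q2)).
have p1 : 0 < 1 - q1 by rewrite subr_gt0.
have p2 : 0 < 1 - q2 by rewrite subr_gt0.
have s0 q : 0 < q -> 0 <= - (C / 4 * ln (1 - q)).
  move=> q0; rewrite -mulrN mulr_ge0 ?oppr_ge0 ?ln_le0 ?gerBl ?(ltW q0)//.
  by rewrite divr_ge0// ltW.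
have -> : t = s1 + s2.
  have := congr1 (@ln R) qt; rewrite lnM ?posrE// expRK => h.
  rewrite /s1 /s2 -opprD -mulrDr h; field; by rewrite gt_eqF.
have s10 : 0 <= s1 by exact: s0.
have s20 : 0 <= s2 by exact: s0.
rewrite evolveD// mean_evolve_sym.
have F0 := evolve_gt0 s10 f0; have G0 := evolve_gt0 s20 g0.
have FG x : 0 < evolve s1 f x * evolve s2 g x by rewrite mulr_gt0.
have p0 x := ltW (hp.1 x).
rewrite -[leRHS]lnK ?posrE ?ler_expR; last exact: wmean_gt0 p0 hp.2 FG.
apply: le_trans (sum_ln_le_ln_sum p0 hp.2 FG).
under eq_bigr do rewrite lnM ?posrE// mulrDr.
by rewrite big_split/=; apply: lerD; apply: logNorm_le_mean_ln_evolve.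
Qed.

(** * Lower bound for two sets *)

Lemma mass1_mem (A : {set Omega}) : mass p A = 1 -> forall x, x \in A.
Proof.
move=> A1 x; apply/negPn/negP => xA.
have : \sum_(y | y \notin A) p y = 0.
  have := hp.2; rewrite (bigID (mem A))/= -/(mass p A) A1 => h.
  by apply: (addrI 1); rewrite h addr0.
move/psumr_eq0P => /(_ (fun y _ => ltW (hp.1 y)) x xA) px0.
by have := hp.1 x; rewrite px0 ltxx.
Qed.

Definition joint_mass (t : R) (A B : {set Omega}) : R :=
  \sum_(x in A) p x * \sum_(y in B) K t x y.

Lemma joint_mass_meanE t A B :
  joint_mass t A B = mean p (fun x => (x \in A)%:R * evolve t (fun y => (y \in B)%:R) x).
Proof.
rewrite /joint_mass big_mkcond; apply: eq_bigr => x _.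
case: (x \in A); rewrite ?mul0r ?mulr0// mul1r big_mkcond/=; congr (_ * _).
by apply: eq_bigr => y _; case: (y \in B); rewrite ?mulr1 ?mulr0.
Qed.

Lemma mean_cst c : mean p (fun=> c) = c.
Proof. by rewrite /mean -mulr_suml hp.2 mul1r. Qed.

Lemma mean_mem (A : {set Omega}) : mean p (fun x => (x \in A)%:R) = mass p A.
Proof.
rewrite /mass big_mkcond; apply: eq_bigr => x _.
by case: (x \in A); rewrite ?mulr1 ?mulr0.
Qed.

Lemma mass_le1 A : mass p A <= 1.
Proof.
rewrite -hp.2 /mass big_mkcond; apply: ler_sum => x _.
by case: ifP => // _; exact: ltW (hp.1 x).
Qed.

Lemma mass_le_logNorm (q e : R) (A : {set Omega}) : 0 < q -> 0 < e -> 0 < mass p A ->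
  ln (mass p A) / q <= logNorm q (fun x => (x \in A)%:R + e).
Proof.
move=> q0 e0 A0; rewrite /logNorm ler_wpM2r ?invr_ge0 ?(ltW q0)//.
have h : mass p A <= mean p (fun x => expR (q * ln ((x \in A)%:R + e))).
  rewrite /mass big_mkcond; apply: ler_sum => x _; have p0 := ltW (hp.1 x).
  case: ifP => xA; last by rewrite mulr_ge0// expR_ge0.
  rewrite -[leLHS]mulr1 ler_wpM2l// -[leLHS](@expR0 R) ler_expR mulr_ge0 ?(ltW q0)//.
  by rewrite ln_ge0// lerDl ltW.
by rewrite ler_ln ?posrE// (lt_le_trans A0).
Qed.

(** [reverse_holder] requires positive functions, so it is applied to the
indicators plus a constant [e].  This only increases the norms and changes the
mean by at most [3 e]. *)
Lemma joint_lower_bound_exponents (q1 q2 t : R) (A B : {set Omega}) :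
  0 <= t -> 0 < q1 < 1 -> 0 < q2 < 1 ->
  (1 - q1) * (1 - q2) = expR (- (4 * t / C)) ->
  0 < mass p A -> 0 < mass p B ->
  expR (ln (mass p A) / q1 + ln (mass p B) / q2) <= joint_mass t A B.
Proof.
move=> t0 /[dup] q1P /andP[q10 _] /[dup] q2P /andP[q20 _] qt A0 B0.
apply/ler_addgt0Pr => d d0.
pose e := Num.min 1 (d / 3).
have e0 : 0 < e by rewrite lt_min ltr01 divr_gt0.
have e1 : e <= 1 by rewrite ge_min lexx.
have ed : e <= d / 3 by rewrite ge_min lexx orbT.
have i0 (D : {set Omega}) x : 0 < (x \in D)%:R + e by rewrite ltr_wpDl.
have := reverse_holder q1P q2P qt (i0 A) (i0 B).
have H := lerD (mass_le_logNorm q10 e0 A0) (mass_le_logNorm q20 e0 B0).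
rewrite -ler_expR in H; move=> /(le_trans H)/le_trans; apply.
pose u x := evolve t (fun y => (y \in B)%:R) x.
have evolveE x : evolve t (fun y => (y \in B)%:R + e) x = u x + e.
  rewrite /u /evolve; under eq_bigr do rewrite mulrDr.
  by rewrite big_split/= -mulr_suml (kernel_sum1 hK)// mul1r.
have -> : mean p (fun x => ((x \in A)%:R + e) * evolve t (fun y => (y \in B)%:R + e) x) =
    joint_mass t A B + (e * mass p B + e * mass p A + e * e).
  have -> : e * mass p B = mean p (fun x => e * u x).
    rewrite -mean_mem -(mean_evolve _ t0) /mean mulr_sumr.
    by apply: eq_bigr => x _; rewrite mulrCA.
  have -> : e * mass p A = mean p (fun x => (x \in A)%:R * e).
    by rewrite -mean_mem mulrC /mean mulr_suml; apply: eq_bigr => x _; rewrite mulrA.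
  rewrite -[X in _ + (_ + X)](mean_cst (e * e)) joint_mass_meanE /mean -!big_split/=.
  by apply: eq_bigr => x _; rewrite evolveE -/(u x); ring.
rewrite lerD2l.
have : e * mass p B <= e * 1 by rewrite ler_wpM2l ?(ltW e0)// mass_le1.
have : e * mass p A <= e * 1 by rewrite ler_wpM2l ?(ltW e0)// mass_le1.
have : e * e <= e * 1 by rewrite ler_wpM2l ?(ltW e0).
lra.
Qed.

Lemma joint_mass_full_left t A B : 0 <= t -> mass p A = 1 ->
  joint_mass t A B = mass p B.
Proof.
move=> t0 A1; rewrite joint_mass_meanE -mean_mem -[RHS](mean_evolve _ t0).
by apply: eq_bigr => x _; rewrite mass1_mem//= mul1r.
Qed.

Lemma joint_mass_full_right t A B : 0 <= t -> mass p B = 1 ->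
  joint_mass t A B = mass p A.
Proof.
move=> t0 B1; apply: eq_bigr => x _.
rewrite (eq_bigl xpredT) ?(kernel_sum1 hK) ?mulr1// => y.
by rewrite mass1_mem.
Qed.

(** The exponents are [q1 = (1 - r^2) a / (a + r b)] and
[q2 = (1 - r^2) b / (b + r a)] with [r = e^(-2t/C)].  They degenerate when [a] or
[b] vanishes, but then the set is the whole space and the probability is the mass
of the other set. *)
Lemma joint_lower_bound (a b t : R) (A B : {set Omega}) : 0 <= a -> 0 <= b ->
  mass p A = expR (- (a ^+ 2 / 2)) -> mass p B = expR (- (b ^+ 2 / 2)) -> 0 < t ->
  expR (- (1 / 2) * ((a ^+ 2 + 2 * expR (- (2 * t / C)) * a * b + b ^+ 2) /
       (1 - expR (- (4 * t / C))))) <= joint_mass t A B.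
Proof.
move=> a0 b0 hA hB t0.
have rE : expR (- (4 * t / C)) = expR (- (2 * t / C)) ^+ 2.
  by rewrite -expRM_natl; congr expR; ring.
have r1 : expR (- (2 * t / C)) < 1.
  by rewrite expR_lt1 oppr_lt0 divr_gt0// mulr_gt0.
have := expR_gt0 (- (2 * t / C)).
rewrite rE; set r := expR _ in r1 rE * => r0.
have s0 : 0 < 1 - r ^+ 2 by rewrite subr_gt0 exprn_ilt1// ltW.
have s1 : 1 - r ^+ 2 <= 1 by rewrite gerBl exprn_ge0// ltW.
have gauss_le (c : R) :
    expR (- (1 / 2) * (c ^+ 2 / (1 - r ^+ 2))) <= expR (- (c ^+ 2 / 2)).
  rewrite ler_expR mulNr lerN2 [leRHS]mulrC div1r ler_wpM2r ?invr_ge0//.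
  by rewrite ler_pdivlMr// ler_piMr// sqr_ge0.
have [a00|/eqP a00] := eqVneq a 0.
  rewrite a00 expr0n/= mulr0 mul0r !add0r joint_mass_full_left ?(ltW t0)//.
    by rewrite hB.
  by rewrite hA a00 expr0n/= mul0r oppr0 expR0.
have [b00|/eqP b00] := eqVneq b 0.
  rewrite b00 expr0n/= mulr0 !addr0 joint_mass_full_right ?(ltW t0)//.
    by rewrite hA.
  by rewrite hB b00 expr0n/= mul0r oppr0 expR0.
have ap : 0 < a by rewrite lt_neqAle a0 andbT eq_sym; apply/eqP.
have bp : 0 < b by rewrite lt_neqAle b0 andbT eq_sym; apply/eqP.
have u0 : 0 < a + r * b by rewrite addr_gt0// mulr_gt0.
have v0 : 0 < b + r * a by rewrite addr_gt0// mulr_gt0.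
have E1 : 1 - (1 - r ^+ 2) * a / (a + r * b) = r * (b + r * a) / (a + r * b).
  by field; rewrite gt_eqF.
have E2 : 1 - (1 - r ^+ 2) * b / (b + r * a) = r * (a + r * b) / (b + r * a).
  by field; rewrite gt_eqF.
have P1 : 0 < (1 - r ^+ 2) * a / (a + r * b) < 1.
  by rewrite divr_gt0 ?mulr_gt0//= -subr_gt0 E1 divr_gt0 ?mulr_gt0//.
have P2 : 0 < (1 - r ^+ 2) * b / (b + r * a) < 1.
  by rewrite divr_gt0 ?mulr_gt0//= -subr_gt0 E2 divr_gt0 ?mulr_gt0//.
have E : (1 - (1 - r ^+ 2) * a / (a + r * b)) * (1 - (1 - r ^+ 2) * b / (b + r * a)) =
    expR (- (4 * t / C)).
  by rewrite E1 E2 rE; field; rewrite !gt_eqF.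
have := @joint_lower_bound_exponents _ _ t A B (ltW t0) P1 P2 E.
rewrite hA hB !expR_gt0 => /(_ isT isT); rewrite !expRK; apply: le_trans.
rewrite ler_expR le_eqVlt; apply/orP; left; apply/eqP; field.
by rewrite !gt_eqF.
Qed.

End reverse_hypercontractivity.

(** * The matrix exponential *)

Section heat_kernel.
Context {R : realType} {Omega : finType}.
Variable Q : Omega -> Omega -> R.
Implicit Types f g : Omega -> R.

Definition gen f : Omega -> R := fun x => \sum_y Q x y * f y.

Let genE f x : gen f x = \sum_y Q x y * f y.
Proof. by []. Qed.

Definition heat_coef f x (k : nat) : R := iter k gen f x / k`!%:R.

(** [op_exp] rescales the operator inside the iteration; collecting the powers of
the time gives a genuine power series in [s], to which termwise differentiation
applies. *)
Definition heat (s : R) f x : R := limn (pseries (heat_coef f x) s).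

Lemma op_exp_heat s f x : op_exp (fun g z => - s * genL Q g z) f x = heat s f x.
Proof.
rewrite /op_exp /heat; congr (limn (series _)); apply/funext => k.
have iterE z : iter k (fun g z => - s * genL Q g z) f z = s ^+ k * iter k gen f z.
  elim: k z => [|k IH] z; first by rewrite mul1r.
  rewrite iterS /genL mulrNN [in RHS]iterS genE exprS !mulr_sumr.
  by apply: eq_bigr => y _; rewrite IH; ring.
by rewrite iterE /= /heat_coef; ring.
Qed.

Lemma iter_gen_bound f : exists N M : R, [/\ 0 <= N, 0 <= M &
  forall k x, `|iter k gen f x| <= N ^+ k * M].
Proof.
pose N := \sum_x \sum_y `|Q x y|; pose M := \sum_x `|f x|.
have N0 : 0 <= N by apply: sumr_ge0 => x _; apply: sumr_ge0.
have M0 : 0 <= M by apply: sumr_ge0.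
exists N, M; split=> //; elim=> [|k IH] x.
  by rewrite mul1r /M (bigD1 x)//= lerDl sumr_ge0.
rewrite iterS genE exprS -mulrA; apply: (le_trans (ler_norm_sum _ _ _)).
apply: (@le_trans _ _ ((\sum_y `|Q x y|) * (N ^+ k * M))).
  rewrite mulr_suml; apply: ler_sum => y _.
  by rewrite normrM ler_wpM2l.
rewrite ler_wpM2r ?mulr_ge0 ?exprn_ge0//.
rewrite /N [leRHS](bigD1 x)//= lerDl sumr_ge0// => z _; exact: sumr_ge0.
Qed.

Lemma cvg_heat_series f x s : cvgn (pseries (heat_coef f x) s).
Proof.
have [N [M [N0 M0 NM]]] := iter_gen_bound f.
apply: normed_cvg; apply: (@series_le_cvg _ _ (M *: exp_coeff (N * `|s|))).
- by move=> k; exact: normr_ge0.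
- by move=> k; rewrite mulr_ge0// divr_ge0// exprn_ge0// mulr_ge0.
- move=> k; rewrite /= /heat_coef !normrM normfV normrX normr_nat.
  have -> : (M *: exp_coeff (N * `|s|)) k = N ^+ k * M / k`!%:R * `|s| ^+ k.
    transitivity (M * ((N * `|s|) ^+ k / k`!%:R)) => //.
    by rewrite exprMn; ring.
  by rewrite ler_wpM2r ?exprn_ge0// ler_wpM2r// invr_ge0.
- exact/is_cvg_seriesZ/is_cvg_series_exp_coeff.
Qed.

(** Linear identities between the iterates of the generator, with coefficients
independent of the order [k], pass to the exponential. *)
Lemma heat_lin (I : finType) (a : I -> R) (F : I -> Omega -> R) (z : I -> Omega)
    f x s :
  (forall k, iter k gen f x = \sum_i a i * iter k gen (F i) (z i)) ->
  heat s f x = \sum_i a i * heat s (F i) (z i).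
Proof.
move=> fF; apply/cvg_lim => //.
have -> : pseries (heat_coef f x) s =
    \sum_i (fun n => a i * pseries (heat_coef (F i) (z i)) s n).
  apply/funext => n; rewrite fct_sumE /pseries /series/=.
  under [RHS]eq_bigr do rewrite mulr_sumr.
  rewrite [RHS]exchange_big/=; apply: eq_bigr => k _.
  rewrite /heat_coef fF !mulr_suml; apply: eq_bigr => i _; ring.
elim/big_ind2 : _ => [|u l v m ul vm|i _]; first exact: cvg_cst.
  exact: cvgD.
by apply: cvgM; [exact: cvg_cst|exact: cvg_heat_series].
Qed.

(** The backward equation: differentiating the series shifts its coefficients,
which amounts to replacing [f] by [gen f]. *)
Lemma is_derive_heat (s : R) f x :
  is_derive s 1 (fun s => heat s f x) (\sum_y Q x y * heat s f y).
Proof.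
have diffE g : pseries_diffs (heat_coef g x) = heat_coef (gen g) x.
  apply/funext => k; rewrite /pseries_diffs /heat_coef iterSr factS natrM.
  by rewrite mulrCA invfM mulVKf ?pnatr_eq0.
have -> : \sum_y Q x y * heat s f y = heat s (gen f) x.
  by apply/esym/heat_lin => k; rewrite -iterSr iterS.
rewrite /heat -diffE; apply: (@pseries_snd_diffs _ _ (`|s| + 1)).
- exact: cvg_heat_series.
- by rewrite diffE; exact: cvg_heat_series.
- by rewrite !diffE; exact: cvg_heat_series.
- by rewrite [ltRHS]ger0_norm ?addr_ge0// ltrDl.
Qed.

Definition indic1 (y : Omega) : Omega -> R := fun x => (x == y)%:R.

Lemma iter_gen_linE k f x : iter k gen f x = \sum_y f y * iter k gen (indic1 y) x.
Proof.
elim: k x => [|k IH] x.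
  rewrite (bigD1 x)//= /indic1 eqxx mulr1 big1 ?addr0// => y yx.
  by rewrite eq_sym (negPf yx) mulr0.
rewrite iterS genE; under eq_bigr do rewrite IH mulr_sumr.
rewrite exchange_big/=; apply: eq_bigr => y _; rewrite genE mulr_sumr.
by apply: eq_bigr => z _; rewrite mulrCA.
Qed.

Definition heat_kernel (s : R) (x y : Omega) : R := heat s (indic1 y) x.

Lemma heat_kernel_derive (s : R) x y :
  is_derive s 1 (fun s => heat_kernel s x y) (\sum_z Q x z * heat_kernel s z y).
Proof. exact: is_derive_heat. Qed.

Lemma iter_gen_rev (p : Omega -> R) k x y : reversible Q p ->
  p x * iter k gen (indic1 y) x = p y * iter k gen (indic1 x) y.
Proof.
move=> hrev; elim: k x y => [|k IH] x y.
  by rewrite /= /indic1 eq_sym; case: eqVneq => [->|]; rewrite ?mulr0.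
rewrite iterS iterSr genE iter_gen_linE !mulr_sumr; apply: eq_bigr => z _.
have -> : gen (indic1 x) z = Q z x.
  rewrite genE (bigD1 x)//= /indic1 eqxx mulr1 big1 ?addr0// => u ux.
  by rewrite (negPf ux) mulr0.
by rewrite mulrA hrev mulrAC IH; ring.
Qed.

Lemma heat_kernel_rev (p : Omega -> R) s x y : (forall x, 0 < p x) -> reversible Q p ->
  p x * heat_kernel s x y = p y * heat_kernel s y x.
Proof.
move=> p0 hrev.
(* A sum with a single term, to transport [iter_gen_rev] through [heat_lin]. *)
rewrite /heat_kernel (@heat_lin 'I_1 (fun=> p y / p x) (fun=> indic1 x) (fun=> y)).
  by rewrite big_ord1; field; rewrite gt_eqF.
move=> k; rewrite big_ord1; apply: (mulfI (lt0r_neq0 (p0 x))).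
by rewrite iter_gen_rev//; field; rewrite gt_eqF.
Qed.

End heat_kernel.

(** * The transition kernel of the chain and its two-set bound *)

Section chain.
Context {R : realType} {d : measure_display} {T : measurableType d}.
Context {Omega : finType}.
Variables (Px : Omega -> probability T R) (X : R -> T -> Omega).
Variable Q : Omega -> Omega -> R.
Hypothesis hX : markov_chain Px X Q.

Lemma measurable_state (s : R) y : 0 <= s -> measurable [set w | X s w = y].
Proof. by move=> s0; have [mX _ _ _] := hX; exact: (mX s y s0). Qed.

Lemma measure_state_mem (P : probability T R) (s : R) (D : set T) (B : {set Omega}) :
  0 <= s -> measurable D ->
  P (D `&` [set w | X s w \in B]) = (\sum_(y in B) P (D `&` [set w | X s w = y]))%E.
Proof.
move=> s0 mD; have mX y := measurable_state y s0.
rewrite -big_enum/= fsbig_seq ?enum_uniq//=.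
rewrite -measure_fin_bigcup//.
- congr (P _); apply/seteqP; split=> w /=.
    by move=> [Dw wB]; exists (X s w) => //=; rewrite mem_enum.
  by move=> [y /=]; rewrite mem_enum => yB [Dw wy]; split=> //=; rewrite wy.
- move=> x y _ _ [w [[_ /= <-] [_ /= <-]]] //.
- by move=> y _; exact: measurableI.
Qed.

Lemma chain_prob_heat (s : R) x y : 0 <= s ->
  Px x [set w | X s w = y] = (heat_kernel Q s x y)%:E.
Proof.
move=> s0; have [_ _ _ [_ /(_ s (indic1 y) x s0)]] := hX.
rewrite op_exp_heat -/(heat_kernel Q s x y) => <-.
rewrite /semigroup (_ : (fun w => _) = \1_[set w | X s w = y]).
  rewrite expectation_indic; last exact: measurable_state.
  by rewrite fineK// fin_num_measure//; exact: measurable_state.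
apply/funext => w; rewrite indicE /indic1.
by case: eqP => h; [rewrite mem_set|rewrite memNset].
Qed.

Lemma chain_reversible_semigroup (p : Omega -> R) :
  is_pos_prob p -> reversible Q p -> reversible_semigroup Q p (heat_kernel Q).
Proof.
move=> hp hrev; have [_ X0 PxM _] := hX.
have K0 (s : R) x y : 0 <= s -> 0 <= heat_kernel Q s x y.
  by move=> s0; rewrite -lee_fin -chain_prob_heat.
have K1 (s : R) x : 0 <= s -> \sum_y heat_kernel Q s x y = 1.
  move=> s0; apply: EFin_inj; rewrite -sumEFin.
  have := measure_state_mem (Px x) [set: Omega] s0 measurableT.
  rewrite [X in Px x X](_ : _ = setT).
    rewrite probability_setT => ->; apply: eq_big => [y|y _]; first by rewrite inE.
    by rewrite setTI chain_prob_heat.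
  by apply/seteqP; split=> // w _; split=> //=; rewrite inE.
(* The chain started at [x] is at [x] at time [0]; the rest of the row vanishes. *)
have diag x : heat_kernel Q 0 x x = 1.
  by apply: EFin_inj; rewrite -chain_prob_heat.
split=> //.
- move=> x y; have [<-//|xy] := eqVneq x y.
  have := K1 0 x (lexx 0); rewrite (bigD1 x)//= diag => h.
  have /psumr_eq0P : \sum_(i | i != x) heat_kernel Q 0 x i = 0.
    by apply: (addrI 1); rewrite h addr0.
  by apply=> [z _|]; [exact: K0|rewrite eq_sym].
- move=> s t x z s0 t0; apply: EFin_inj.
  rewrite -chain_prob_heat ?addr_ge0// -sumEFin.
  have := measure_state_mem (Px x) [set: Omega] s0 (measurable_state z (addr_ge0 s0 t0)).
  rewrite (_ : _ `&` _ = [set w | X (s + t) w = z]).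
    move=> ->; apply: eq_big => [y|y _]; first by rewrite inE.
    have := PxM x 0%N (fun=> s) (fun=> y) t z s0 (fun=> lexx s) t0.
    rewrite (_ : [set w | forall i, _ -> _] = [set w | X s w = y]).
      by rewrite setIC !chain_prob_heat.
    by apply/seteqP; split=> w /= h; [exact: (h 0%N)|].
  by apply/seteqP; split=> w /=; [case|split=> //; rewrite inE].
- by move=> s x y; apply: heat_kernel_rev => //; exact: hp.1.
- by move=> s x y; exact: heat_kernel_derive.
Qed.

Lemma chain_joint_mass (p : Omega -> R) (P : probability T R) (t : R)
    (A B : {set Omega}) :
  chain_law_from Px X p P -> 0 <= t ->
  P [set w | X 0 w \in A /\ X t w \in B] = (joint_mass p (heat_kernel Q) t A B)%:E.
Proof.
move=> [PM P0] t0; have m0 x := measurable_state x (lexx 0).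
have mt y := measurable_state y t0.
have mA : measurable [set w | X 0 w \in A].
  rewrite (_ : [set w | _] = \big[setU/set0]_(x in A) [set w | X 0 w = x]).
    exact: bigsetU_measurable.
  rewrite -big_enum/= -bigcup_seq; apply/seteqP; split=> w /=.
    by move=> wA; exists (X 0 w) => //=; rewrite mem_enum.
  by move=> [x /=]; rewrite mem_enum => xA ->.
rewrite (measure_state_mem P B t0 mA) /joint_mass.
under eq_bigr => y _ do rewrite setIC (measure_state_mem P A (lexx 0) (mt y)).
rewrite exchange_big/= -sumEFin; apply: eq_bigr => x _.
rewrite mulr_sumr -sumEFin; apply: eq_bigr => y _.
have := PM 0%N (fun=> 0) (fun=> x) t y (lexx 0) (fun=> lexx 0) t0.
rewrite add0r (_ : [set w | forall i, _ -> _] = [set w | X 0 w = x]).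
  by rewrite P0 chain_prob_heat// setIC.
by apply/seteqP; split=> w /= h; [exact: (h 0%N)|].
Qed.

End chain.

Theorem theorem1p14 (R : realType) (d : measure_display) (T : measurableType d)
    (Omega : finType)
    (Px : Omega -> probability T R) (X : R -> T -> Omega)
    (Q : Omega -> Omega -> R) (p : Omega -> R)
    (hX : markov_chain Px X Q)
    (hp : is_pos_prob p) (hrev : reversible Q p)
    (C : R) (hC : 0 < C) (hLS : logSob1 Q p C)
    (a b : R) (ha : 0 <= a) (hb : 0 <= b)
    (A B : {set Omega})
    (hA : mass p A = expR (- (a ^+ 2 / 2)))
    (hB : mass p B = expR (- (b ^+ 2 / 2)))
    (P : probability T R) (hP : chain_law_from Px X p P)
    (t : R) (ht : 0 < t) :
  ((expR (- (1 / 2) *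
      ((a ^+ 2 + 2 * expR (- (2 * t / C)) * a * b + b ^+ 2) /
       (1 - expR (- (4 * t / C))))))%:E
   <= P [set w | X 0%R w \in A /\ X t w \in B])%E.
Proof.
have [_ _ _ [hQ _]] := hX.
rewrite (chain_joint_mass hX A B hP (ltW ht)) lee_fin.
have hK := chain_reversible_semigroup hX hp hrev.
exact: (joint_lower_bound hQ hrev hp hK hC hLS).
Qed.
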